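(* Let $d\ge 2$ be an integer and $A\subseteq\mathbf{R}^d$. If $\angle A<\theta_d:=\arccos(-\frac1d)$, then $A$ consists of the vertices of a convex polytope (not necessarily $d$-dimensional); i.e. $A$ is the vertex set of a convex polytope in $\mathbf{R}^d$.
   Context: Angle bound: for a set $A\subseteq \mathbf{R}^{d}$, $\angle A$ denotes the smallest $\theta\in[0,\pi]$ such that no triple of points of $A$ determines an angle greater than $\theta$, i.e. such that $\frac{x-y}{|x-y|}\cdot\frac{z-y}{|z-y|}\ge \cos\theta$ for all $x,y,z\in A$ with $x\ne y$ and $z\neq y$. A convex polytope is the convex hull of a finite set of points (of any dimension; the empty polytope is allowed when $A=\emptyset$). *)

(* Defs.v *)
From mathcomp Require Import all_boot all_order all_algebra.
From mathcomp Require Import all_classical all_reals all_analysis.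
From mathcomp Require Import lra.

Set Implicit Arguments.
Unset Strict Implicit.
Unset Printing Implicit Defensive.

Import Order.TTheory GRing.Theory Num.Theory.

Local Open Scope classical_set_scope.
Local Open Scope ring_scope.

Definition dotp (R : realType) (d : nat) (u v : 'rV[R]_d) : R :=
  \sum_(i < d) u 0 i * v 0 i.

(* The Euclidean norm; the canonical norm [`|u|] on row vectors is the
   maximum norm. *)
Definition enorm (R : realType) (d : nat) (u : 'rV[R]_d) : R :=
  Num.sqrt (dotp u u).

Definition direction (R : realType) (d : nat) (y x : 'rV[R]_d) : 'rV[R]_d :=
  (enorm (x - y))^-1 *: (x - y).

Definition angle_bound (R : realType) (d : nat) (A : set 'rV[R]_d)
    (theta : R) : Prop :=
  0 <= theta <= pi /\
  forall x y z, A x -> A y -> A z -> x <> y -> z <> y ->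
    cos theta <= dotp (direction y x) (direction y z).

(* The infimum is attained, see [angle_smallest]. *)
Definition angle (R : realType) (d : nat) (A : set 'rV[R]_d) : R :=
  inf (angle_bound A).

Definition convex_hull (R : realType) (d : nat) (S : set 'rV[R]_d) :
    set 'rV[R]_d :=
  smallest (@convex_set R 'rV[R]_d) S.

Definition convex_polytope (R : realType) (d : nat) (P : set 'rV[R]_d) : Prop :=
  exists2 S : set 'rV[R]_d, finite_set S & P = convex_hull S.

(* The vertices of a convex polytope are its extreme points. *)
Definition vertices (R : realType) (d : nat) (P : set 'rV[R]_d) :
    set 'rV[R]_d :=
  [set v | P v /\
    forall x y (t : R), P x -> P y -> 0 < t < 1 ->
      v = t *: x + (1 - t) *: y -> x = v /\ y = v].

Lemma dotp_ge0 (R : realType) (d : nat) (u : 'rV[R]_d) : 0 <= dotp u u.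
Proof. by apply: sumr_ge0 => i _; rewrite -expr2 sqr_ge0. Qed.

Lemma dotp_direction (R : realType) (d : nat) (x y : 'rV[R]_d) :
  dotp (direction y x) (direction y x) <= 1.
Proof.
rewrite /direction; set u := x - y; set c := (enorm u)^-1.
have -> : dotp (c *: u) (c *: u) = c ^+ 2 * dotp u u.
  by rewrite /dotp mulr_sumr; apply: eq_bigr => i _; rewrite !mxE mulrACA expr2.
rewrite /c exprVn /enorm sqr_sqrtr ?dotp_ge0//.
by have [->|nz] := eqVneq (dotp u u) 0; rewrite ?mulr0// mulVf.
Qed.

Lemma dotp_directions (R : realType) (d : nat) (x y z : 'rV[R]_d) :
  -1 <= dotp (direction y x) (direction y z).
Proof.
set u := direction y x; set v := direction y z.
have := dotp_ge0 (u + v).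
have -> : dotp (u + v) (u + v) = dotp u u + dotp u v *+ 2 + dotp v v.
  rewrite /dotp -sumrMnl -!big_split; apply: eq_bigr => i _ /=.
  by rewrite !mxE -!expr2 sqrrD.
have := dotp_direction x y; have := dotp_direction z y.
rewrite -/u -/v mulr2n => vv uu uv.
lra.
Qed.

Lemma angle_smallest (R : realType) (d : nat) (A : set 'rV[R]_d) :
  angle_bound A (angle A) /\
  forall theta, angle_bound A theta -> angle A <= theta.
Proof.
have Api : angle_bound A pi.
  split=> [|x y z _ _ _ _ _]; first by rewrite pi_ge0 lexx.
  by rewrite cospi dotp_directions.
have A0 : lbound (angle_bound A) 0 by move=> t [/andP[]].
have Ainf theta : angle_bound A theta -> angle A <= theta.
  by move=> At; apply: ge_inf => //; exists 0.
split=> //; have Age0 : 0 <= angle A by apply: lb_le_inf => //; exists pi.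
have Alepi := Ainf _ Api.
split=> [|x y z Ax Ay Az xy zy]; first by rewrite Age0.
set c := dotp _ _; rewrite leNgt; apply/negP => cA.
have cB : -1 <= c <= 1 by rewrite dotp_directions (le_trans (ltW cA)) ?cos_le1.
have [/andP[t0 tpi] tc] := acos_def cB.
have : acos c <= angle A.
  apply: lb_le_inf; first by exists pi.
  move=> t [/andP[t0' tpi'] /(_ x y z Ax Ay Az xy zy)].
  by rewrite -/c -[X in _ <= X]tc (leNgt (acos c)) -ltr_cos ?in_itv/= ?t0 ?tpi ?t0' ?tpi'// -leNgt.
by rewrite leNgt -ltr_cos ?in_itv/= ?t0 ?tpi ?Age0 ?Alepi// tc cA.
Qed.

(* Main.v *)
Require Import Defs.
From mathcomp Require Import all_boot all_order all_algebra.
From mathcomp Require Import all_classical all_reals all_analysis.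
From mathcomp Require Import ring lra.

Import Order.TTheory GRing.Theory Num.Theory.

Local Open Scope classical_set_scope.
Local Open Scope ring_scope.

(* Finiteness: colour each ordered pair of points by a cell of the unit sphere
   containing its direction, the cells being so small that unit vectors in the
   same cell have inner product at least 1/2. For a sequence of points [p] in
   [A], let [S i] be the set of colours of the pairs [(p i, p j)] with [i < j].
   If [S i = S j] with [i < j], then the colour of [(p i, p j)] is also that of
   some [(p j, p k)], and the angle at [p j] in the triple [p i, p j, p k] is at
   least [2 pi / 3]. So the [S i] are distinct and the sequence is finite.

   Convex position: it suffices that unit vectors [u_i] with pairwise inner
   products [g_ij > -1/d] satisfy no relation [sum_i c_i u_i = 0] with [c >= 0]
   other than [c = 0]. With [S = sum_i c_i] and [M = sum_i c_i u_i u_i^T], one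
   has [tr M = S], hence [sum_ij c_i c_j g_ij ^ 2 = tr (M ^ 2) >= S ^ 2 / d],
   while [sum_ij c_i c_j g_ij = 0]. So
   [sum_ij c_i c_j (g_ij + 1/d) (1 - g_ij) <= 0]; every term is nonnegative,
   which forces [g_ij = 1] whenever [c_i c_j != 0], and then
   [0 = sum_ij c_i c_j g_ij = S ^ 2]. *)

Lemma infinite_sequence (T : Type) (A : set T) :
  infinite_set A -> exists p : nat -> T, injective p /\ forall i, A (p i).
Proof.
move=> /infiniteP/card_leP[g].
pose s (i : nat) : set_type [set: nat] := SigSub (mem_set (I : [set: nat] i)).
exists (fun i => val (g (s i))); split=> [i j /val_inj gij|i]; last exact: set_valP.
by have /(congr1 val) := inj (mem_set I) (mem_set I) gij.
Qed.

Section DotProduct.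
Context {R : realType} {d : nat}.
Implicit Types (u v w x y z : 'rV[R]_d).

(** * Inner products, norms and directions *)

Lemma dotpC u v : dotp u v = dotp v u.
Proof. by apply: eq_bigr => i _; rewrite mulrC. Qed.

Lemma dotpNl u v : dotp (- u) v = - dotp u v.
Proof. by rewrite /dotp -sumrN; apply: eq_bigr => i _; rewrite mxE mulNr. Qed.

Lemma dotpZl (a : R) u v : dotp (a *: u) v = a * dotp u v.
Proof. by rewrite /dotp mulr_sumr; apply: eq_bigr => i _; rewrite mxE mulrA. Qed.

Lemma dotp_eq0 u : (dotp u u == 0) = (u == 0).
Proof.
apply/eqP/eqP => [|->]; last by apply: big1 => i _; rewrite mxE mul0r.
move=> /eqP; rewrite psumr_eq0 => [/allP u0|i _]; last by rewrite -expr2 sqr_ge0.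
apply/rowP => i; rewrite mxE; apply/eqP.
by have /= := u0 i (mem_index_enum i); rewrite -expr2 sqrf_eq0.
Qed.

Lemma enorm_gt0 u : u != 0 -> 0 < enorm u.
Proof. by move=> u0; rewrite sqrtr_gt0 lt_def dotp_eq0 u0 dotp_ge0. Qed.

Lemma dotp_direction1 x y : x <> y -> dotp (direction y x) (direction y x) = 1.
Proof.
move=> /eqP; rewrite -subr_eq0 => xy.
rewrite /direction dotpZl dotpC dotpZl mulrA -expr2 exprVn.
by rewrite sqr_sqrtr ?dotp_ge0// mulVf// dotp_eq0.
Qed.

Lemma directionN x y : direction y x = - direction x y.
Proof.
rewrite /direction -(opprB y x) scalerN /enorm.
by rewrite dotpNl dotpC dotpNl opprK.
Qed.

(** * Finiteness by colouring directions *)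

Lemma coord_le1 u i : dotp u u = 1 -> -1 <= u 0 i <= 1.
Proof.
move=> u1; have : u 0 i ^+ 2 <= 1.
  rewrite -u1 /dotp (bigD1 i)//= -expr2 lerDl.
  by apply: sumr_ge0 => j _; rewrite -expr2 sqr_ge0.
by rewrite -ler_norml -sqrtr_sqr => u2; rewrite -sqrtr1 ler_wsqrtr.
Qed.

(** A grid of mesh [1 / d]. For a unit vector each coordinate plus 1 lies in [[0, 2]]; the index
    [2 d] is reached when the coordinate is 1, hence [2 d + 1] values, and [inord] then never falls
    back to its default. *)
Definition sphere_cell u : {ffun 'I_d -> 'I_(d.*2).+1} :=
  [ffun i => inord (Num.truncn (d%:R * (u 0 i + 1)))].

(** In a common cell coordinates differ by at most [1 / d], so [|u - v| ^ 2 <= d * d ^- 2 <= 1],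
    while [|u - v| ^ 2 = 2 - 2 * dotp u v]. *)
Lemma sphere_cell_dotp u v :
  dotp u u = 1 -> dotp v v = 1 -> sphere_cell u = sphere_cell v ->
  2^-1 <= dotp u v.
Proof.
move=> u1 v1 uv.
have [d0|d0] := posnP d.
  have : dotp u u = 0 by apply: big1 => i; have := ltn_ord i; rewrite [ltnRHS]d0.
  by move/eqP; rewrite u1 oner_eq0.
have dR : 1 <= d%:R :> R by rewrite ler1n.
have trunc_le w i : dotp w w = 1 ->
    let x := d%:R * (w 0 i + 1) in
    (Num.truncn x)%:R <= x < (Num.truncn x).+1%:R /\
    (Num.truncn x < (d.*2).+1)%N.
  move=> w1 x; have /andP[w_ge w_le] := coord_le1 w i w1.
  have x0 : 0 <= x by rewrite mulr_ge0// -lerBlDr sub0r.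
  have /andP[tx xt] := truncn_itv x0; rewrite tx xt; split=> //.
  rewrite ltnS -(ler_nat R) (le_trans tx)// -muln2 natrM ler_wpM2l//; lra.
have close i : (u 0 i - v 0 i) ^+ 2 <= d%:R ^- 2.
  have [/andP[u_ge u_lt] tu] := trunc_le u i u1.
  have [/andP[v_ge v_lt] tv] := trunc_le v i v1.
  have /(congr1 val) : sphere_cell u i = sphere_cell v i by rewrite uv.
  rewrite !ffunE /= !inordK// => tuv.
  move: u_ge u_lt; rewrite tuv => u_ge u_lt; rewrite -natr1 in u_lt v_lt.
  rewrite -[leRHS]mul1r ler_pdivlMr ?exprn_gt0 ?(lt_le_trans ltr01)//.
  rewrite -exprMn; set s := _ * _.
  have : -1 <= s <= 1 by rewrite /s; apply/andP; split; lra.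
  by rewrite -ler_norml -[s ^+ 2]real_normK ?num_real// expr_le1.
have : \sum_(i < d) (u 0 i - v 0 i) ^+ 2 <= 1.
  rewrite (le_trans (ler_sum _ (fun i _ => close i)))//.
  rewrite sumr_const card_ord -[leLHS]mulr_natl.
  have -> : d%:R * d%:R ^- 2 = d%:R^-1 :> R.
    by field; rewrite gt_eqF// (lt_le_trans ltr01).
  by rewrite invf_le1// (lt_le_trans ltr01).
have -> : \sum_(i < d) (u 0 i - v 0 i) ^+ 2 = dotp u u + dotp v v - 2 * dotp u v.
  rewrite /dotp mulr_sumr -sumrN -!big_split; apply: eq_bigr => i _ /=; ring.
rewrite u1 v1; lra.
Qed.

Lemma finite_of_dotp (A : set 'rV[R]_d) :
  (forall x y z, A x -> A y -> A z -> x <> y -> z <> y ->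
    - 2^-1 < dotp (direction y x) (direction y z)) ->
  finite_set A.
Proof.
move=> obtuse; apply: contrapT => /infinite_sequence[p [p_inj Ap]].
have pI i j : i != j -> p j <> p i.
  by move=> ij /p_inj ji; rewrite ji eqxx in ij.
pose cell i j := sphere_cell (direction (p i) (p j)).
pose S i := [set c | `[< exists2 j, (i < j)%N & cell i j = c >]]%SET.
(* Pigeonhole: [n] counts the possible sets of colours, so [S] repeats among the first [n + 1]
   indices. *)
pose n := #|{set {ffun 'I_d -> 'I_(d.*2).+1}}|.
have /injectivePn[i [j ij Sij]] : ~~ injectiveb (fun i : 'I_n.+1 => S i).
  by apply/injectiveP => /leq_card; rewrite card_ord ltnn.
wlog ltij : i j ij Sij / (i < j)%N.
  move=> wlg; have := ij; rewrite -val_eqE neq_ltn => /orP[|] lt_ij.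
    exact: (wlg i j).
  by apply: (wlg j i) => //; rewrite eq_sym.
(* The colour of the pair [(i, j)] lies in [S i], hence in [S j], which supplies the third index
   [k]. *)
have : cell i j \in S j.
  by rewrite -Sij inE; apply/asboolP; exists (val j).
rewrite inE => /asboolP[k jk ckj].
have pij : p j <> p i by apply: pI; rewrite ltn_eqF.
have pjk : p k <> p j by apply: pI; rewrite ltn_eqF.
have := sphere_cell_dotp _ _ (dotp_direction1 _ _ pjk)
                                (dotp_direction1 _ _ pij) ckj.
have := obtuse _ _ _ (Ap k) (Ap j) (Ap i) pjk (nesym pij).
(* Reversing the direction from [p i] to [p j] turns the lower bound [1/2] into an upper bound
   [-1/2] for the cosine at [p j]. *)
rewrite (directionN (p i)) [dotp _ (- _)]dotpC dotpNl dotpC; lra.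
Qed.

(** * Nonnegative linear relations between unit vectors *)

Lemma posrel_eq0 (n : nat) (u : 'I_n -> 'rV[R]_d) (c : 'I_n -> R) :
  (0 < d)%N -> (forall i, dotp (u i) (u i) = 1) ->
  (forall i j, - d%:R^-1 < dotp (u i) (u j)) ->
  (forall i, 0 <= c i) -> \sum_i c i *: u i = 0 -> forall i, c i = 0.
Proof.
move=> d0 u1 gt_u c0 rel.
pose g i j := dotp (u i) (u j).
have dR : 0 < d%:R :> R by rewrite ltr0n.
pose S := \sum_i c i.
pose M k l := \sum_i c i * (u i 0 k * u i 0 l).
have rel_k k : \sum_i c i * u i 0 k = 0.
  have /rowP/(_ k) := rel; rewrite summxE mxE => rk; rewrite -[RHS]rk.
  by apply: eq_bigr => i _; rewrite mxE.
(* The double sum is the squared norm of the vanishing combination. *)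
have g0 : \sum_i \sum_j c i * c j * g i j = 0.
  transitivity (\sum_k (\sum_i c i * u i 0 k) * (\sum_j c j * u j 0 k)); last first.
    by apply: big1 => k _; rewrite rel_k mul0r.
  under [RHS]eq_bigr do rewrite big_distrlr.
  rewrite [RHS]exchange_big; apply: eq_bigr => i _.
  rewrite [RHS]exchange_big; apply: eq_bigr => j _.
  by rewrite /g /dotp mulr_sumr; apply: eq_bigr => k _; rewrite mulrACA.
(* Both sides are [tr (M ^ 2)], the right one as the squared Frobenius norm of the symmetric matrix
   [M]. *)
have g2 : \sum_i \sum_j c i * c j * g i j ^+ 2 = \sum_k \sum_l M k l ^+ 2.
  under [RHS]eq_bigr do under eq_bigr do rewrite expr2 /M big_distrlr.
  under [RHS]eq_bigr do rewrite exchange_big.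
  rewrite [RHS]exchange_big; apply: eq_bigr => i _.
  under [RHS]eq_bigr do rewrite exchange_big.
  rewrite [RHS]exchange_big; apply: eq_bigr => j _.
  rewrite /g /dotp expr2 big_distrlr mulr_sumr; apply: eq_bigr => k _.
  rewrite mulr_sumr; apply: eq_bigr => l _ /=; ring.
have SS : \sum_i \sum_j c i * c j = S ^+ 2 by rewrite expr2 big_distrlr.
have trM : \sum_k M k k = S.
  rewrite exchange_big; apply: eq_bigr => i _ /=.
  by rewrite -mulr_sumr -[RHS]mulr1 -(u1 i).
have trM2 : S ^+ 2 / d%:R <= \sum_k \sum_l M k l ^+ 2.
  apply: (@le_trans _ _ (\sum_k M k k ^+ 2)); last first.
    apply: ler_sum => k _; rewrite [leRHS](bigD1 k)//= lerDl.
    by apply: sumr_ge0 => l _; rewrite sqr_ge0.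
  (* Cauchy-Schwarz for the diagonal of [M], by expanding the squared deviations of its entries from
     their mean [S / d]. *)
  have : 0 <= \sum_k (M k k - S / d%:R) ^+ 2.
    by apply: sumr_ge0 => k _; rewrite sqr_ge0.
  have -> : \sum_k (M k k - S / d%:R) ^+ 2 =
      \sum_k M k k ^+ 2 - 2 * (S / d%:R) * \sum_k M k k +
      \sum_(k < d) (S / d%:R) ^+ 2.
    rewrite mulr_sumr -sumrN -!big_split; apply: eq_bigr => k _ /=; ring.
  rewrite trM sumr_const card_ord -[X in _ + X]mulr_natl.
  have -> : d%:R * (S / d%:R) ^+ 2 = S ^+ 2 / d%:R by field; rewrite gt_eqF.
  have -> : 2 * (S / d%:R) * S = 2 * (S ^+ 2 / d%:R) by ring.
  lra.
have g_le1 i j : g i j <= 1.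
  have : 0 <= dotp (u i - u j) (u i - u j) by exact: dotp_ge0.
  have -> : dotp (u i - u j) (u i - u j) = g i i + g j j - 2 * g i j.
    rewrite /g /dotp mulr_sumr -sumrN -!big_split; apply: eq_bigr => k _ /=.
    rewrite !mxE; ring.
  rewrite /g !u1; lra.
pose T i j := c i * c j * ((g i j + d%:R^-1) * (1 - g i j)).
have gd i j : 0 < g i j + d%:R^-1 by rewrite -ltrBlDr sub0r gt_u.
have T_ge0 i j : 0 <= T i j.
  by rewrite !mulr_ge0 ?subr_ge0// ltW.
have T_le0 : \sum_i \sum_j T i j <= 0.
  suff -> : \sum_i \sum_j T i j =
      (1 - d%:R^-1) * (\sum_i \sum_j c i * c j * g i j)
      - \sum_i \sum_j c i * c j * g i j ^+ 2 + d%:R^-1 * \sum_i \sum_j c i * c j.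
    by rewrite g0 g2 SS; lra.
  rewrite !mulr_sumr -sumrN -!big_split; apply: eq_bigr => i _ /=.
  rewrite !mulr_sumr -sumrN -!big_split; apply: eq_bigr => j _ /=.
  rewrite /T; ring.
have T0 i j : T i j = 0.
  apply/eqP; rewrite eq_le T_ge0 andbT (le_trans _ T_le0)//.
  rewrite (bigD1 i)//= (bigD1 j)//= -addrA lerDl addr_ge0 ?sumr_ge0// => k _.
  by rewrite sumr_ge0.
have S0 : S = 0.
  (* Termwise, [T i j = 0] gives [c i * c j = 0] or [g i j = 1]; either way
     [c i * c j = c i * c j * g i j], so [S ^ 2] equals the sum in [g0]. *)
  apply/eqP; rewrite -sqrf_eq0 -SS -[X in _ == X]g0; apply/eqP.
  apply: eq_bigr => i _; apply: eq_bigr => j _.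
  have /eqP := T0 i j.
  rewrite /T !mulf_eq0 (gt_eqF (gd i j)) /= -mulf_eq0 subr_eq0.
  by case/orP => /eqP; [move=> ->; rewrite mul0r|move=> <-; rewrite mulr1].
move=> i; apply/eqP; move/eqP: S0.
by rewrite psumr_eq0// => /allP/(_ i); rewrite mem_index_enum => /(_ isT).
Qed.

(** * Convex hulls and their extreme points *)

Lemma convex_hullS (A : set 'rV[R]_d) : A `<=` convex_hull A.
Proof. by move=> x Ax B [_]; apply. Qed.

Lemma convex_hull_min (A B : set 'rV[R]_d) :
  (forall x y (t : R), B x -> B y -> 0 < t < 1 -> B (t *: x + (1 - t) *: y)) ->
  A `<=` B -> convex_hull A `<=` B.
Proof.
move=> cB AB x; apply; split=> //; apply/convex_setW.
move=> y z /set_mem By /set_mem Bz k k0 k1; apply/mem_set.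
by apply: (cB y z k%:num By Bz); apply/andP.
Qed.

Lemma convex_hull_conv (A : set 'rV[R]_d) x y (t : R) :
  convex_hull A x -> convex_hull A y -> 0 < t < 1 ->
  convex_hull A (t *: x + (1 - t) *: y).
Proof.
move=> Ax Ay /andP[t0 t1] B [cB AB].
have t01 : Itv.spec (@Itv.num_sem R) (Itv.Real `[0%Z, 1%Z]) t.
  by rewrite /= /Itv.num_sem /= num_real in_itv /= !ltW.
have := cB x y (Itv.mk t01).
by rewrite !inE; apply; [exact: Ax|exact: Ay].
Qed.

(** Deleting an extreme point from the hull leaves a convex set; if the point were outside [A], this
    smaller set would still contain [A], against minimality of the hull. *)
Lemma vertices_convex_hull (A : set 'rV[R]_d) : vertices (convex_hull A) `<=` A.
Proof.
move=> v [Pv extr]; apply: contrapT => nAv.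
have /(_ v Pv)[_ //] : convex_hull A `<=` convex_hull A `&` [set x | x <> v].
apply: convex_hull_min => [x y t [Px xv] [Py yv] t01|x Ax].
  split; first exact: convex_hull_conv.
  by move=> /esym/(extr _ _ _ Px Py t01)[/xv].
by split=> [|xv]; [exact: convex_hullS|rewrite xv in Ax].
Qed.

(** The hull lies in the cone with apex [a] generated by the other points. By [posrel_eq0] this cone
    contains no line through [a], so [a] is not inside any segment of it. *)
Lemma vertices_of_dotp (A : set 'rV[R]_d) :
  (0 < d)%N -> finite_set A ->
  (forall x y z, A x -> A y -> A z -> x <> y -> z <> y ->
    - d%:R^-1 < dotp (direction y x) (direction y z)) ->
  A `<=` vertices (convex_hull A).
Proof.
move=> d0 finA obtuse a Aa; split; first exact: convex_hullS.
have /finite_seqP[s As] : finite_set (A `\ a) by exact: finite_setD.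
pose f (i : 'I_(size s)) := s`_i.
have fP i : A (f i) /\ f i <> a.
  by have : (A `\ a) (f i) by rewrite As /= mem_nth.
have fA x : A x -> x <> a -> exists i, f i = x.
  move=> Ax xa; have : x \in s by have : (A `\ a) x by []; rewrite As.
  move=> xs; have lxs := xs; rewrite -index_mem in lxs.
  by exists (Ordinal lxs); exact: nth_index.
pose cone x := exists2 c : 'I_(size s) -> R, (forall i, 0 <= c i) &
  x = a + \sum_i c i *: (f i - a).
have cone0 (c : 'I_(size s) -> R) : (forall i, 0 <= c i) ->
    \sum_i c i *: (f i - a) = 0 -> forall i, c i = 0.
  move=> c0 c_rel i; have en0 j : 0 < enorm (f j - a).
    by rewrite enorm_gt0// subr_eq0; apply/eqP; case: (fP j).
  (* Weighting by the distances to [a] turns the relation into one between unit directions. *)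
  suff /(_ i)/eqP : forall j, c j * enorm (f j - a) = 0.
    by rewrite mulf_eq0 (gt_eqF (en0 i)) orbF => /eqP.
  apply: (posrel_eq0 _ (fun j => direction a (f j))) => //.
  - by move=> j; apply: dotp_direction1; case: (fP j).
  - by move=> j k; have [? ?] := fP j; have [? ?] := fP k; apply: obtuse.
  - by move=> j; rewrite mulr_ge0// ltW.
  rewrite -[RHS]c_rel; apply: eq_bigr => j _.
  by rewrite scalerA -mulrA divff ?mulr1// gt_eqF.
have combE (c e : 'I_(size s) -> R) (t : R) :
    t *: (a + \sum_i c i *: (f i - a)) + (1 - t) *: (a + \sum_i e i *: (f i - a)) =
    a + \sum_i (t * c i + (1 - t) * e i) *: (f i - a).
  rewrite !scalerDr addrACA -scalerDl [t + _]addrC subrK scale1r.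
  congr (_ + _).
  rewrite !scaler_sumr -big_split; apply: eq_bigr => i _ /=.
  by rewrite [RHS]scalerDl !scalerA.
have hull_cone : convex_hull A `<=` cone.
  apply: convex_hull_min => [x y t [c c0 ->] [e e0 ->] /andP[t0 t1]|x Ax].
    rewrite combE; exists (fun i => t * c i + (1 - t) * e i) => // i.
    by rewrite addr_ge0// mulr_ge0// ?subr_ge0 ltW.
  have [->|/eqP xa] := eqVneq x a.
    by exists (fun=> 0) => //; rewrite big1 ?addr0// => i _; rewrite scale0r.
  have [i fi] := fA x Ax xa.
  exists (fun j => (j == i)%:R) => //; rewrite (bigD1 i)//= eqxx scale1r big1.
    by rewrite addr0 fi addrC subrK.
  by move=> j /negPf->; rewrite scale0r.
move=> x y t /hull_cone[c c0 ->] /hull_cone[e e0 ->] /andP[t0 t1].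
rewrite combE -[X in X = _]addr0 => /addrI/esym rel.
have t1' : 0 < 1 - t by rewrite subr_gt0.
have comb_ge0 i : 0 <= t * c i + (1 - t) * e i.
  by rewrite addr_ge0// mulr_ge0// ltW.
(* The combined coefficients vanish and are sums of nonnegative terms with [t] and [1 - t] positive,
   so both endpoints equal [a]. *)
have ce0 i : c i = 0 /\ e i = 0.
  have /eqP := cone0 _ comb_ge0 rel i.
  rewrite paddr_eq0; [|by rewrite mulr_ge0// ltW..].
  by rewrite !mulf_eq0 (gt_eqF t0) (gt_eqF t1') /= => /andP[/eqP ? /eqP ?].
by split; rewrite big1 ?addr0// => i _; have [c_i e_i] := ce0 i;
  rewrite ?c_i ?e_i scale0r.
Qed.

End DotProduct.

Theorem corollary2p2 (R : realType) (d : nat) (A : set 'rV[R]_d) :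
  (2 <= d)%N ->
  angle A < acos (- (d%:R)^-1) ->
  exists2 P : set 'rV[R]_d, convex_polytope P & A = vertices P.
Proof.
move=> d2 angleA.
have d0 : 0 < d%:R :> R by rewrite ltr0n (leq_trans _ d2).
have dV : d%:R^-1 <= 2^-1 :> R by rewrite lef_pV2 ?posrE// ler_nat.
have dV0 : 0 < d%:R^-1 :> R by rewrite invr_gt0.
have d11 : -1 <= - (d%:R : R)^-1 <= 1 by apply/andP; split; lra.
have [[/andP[ge0 lepi] bound] _] := angle_smallest A.
have obtuse x y z : A x -> A y -> A z -> x <> y -> z <> y ->
    - d%:R^-1 < dotp (direction y x) (direction y z).
  (* The bound holds at [angle A] itself, and [cos] is strictly decreasing on [[0, pi]], so the
     inequality is strict. *)
  move=> Ax Ay Az xy zy; apply: lt_le_trans (bound _ _ _ Ax Ay Az xy zy).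
  have [/andP[acos0 acospi] cosK] := acos_def d11.
  by rewrite -[ltLHS]cosK ltr_cos ?in_itv/= ?acos0 ?acospi ?ge0 ?lepi.
have finA : finite_set A.
  apply: finite_of_dotp => x y z Ax Ay Az xy zy.
  (* Here [2 <= d] enters: [-1/2 <= -1/d]. *)
  by apply: le_lt_trans (obtuse x y z Ax Ay Az xy zy); rewrite lerN2.
exists (convex_hull A); first by exists A.
apply/seteqP; split; last exact: vertices_convex_hull.
by apply: vertices_of_dotp => //; exact: ltn_trans d2.
Qed.
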